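(* For every term $a$ of £, with $\mathcal P(a)=\{v\mid v\subset a\}$ and $\mathbf U=\{v\mid v=v\}$: the set $\mathcal P(a)$ is paradoxical if and only if it is not the case that $\Vdash^M\forall x(x\in a\leftrightarrow x\in\mathbf U)$.
   Context: The language of the librationist theory £: variables; primitive set constants $\mathcal T$ (truth set) and $\mathcal F$; atomic formulas $a\in b$; formulas $\downarrow AB$ (joint denial), $\forall vA$; terms $\{v\mid A\}$; name terms $\ulcorner X\urcorner$. $\neg A:=\downarrow AA$, other connectives and $\exists$ classical; $\mathcal TA$ abbreviates $\ulcorner A\urcorner\in\mathcal T$. Identity: $a=b:\equiv\forall u(a\in u\to b\in u)$; $a\subset b:\equiv\forall x(x\in a\to x\in b)$. Semantics: for each $n\in\omega$ and ordinal $\alpha$ a full set $\models^\alpha_n$ of formulas ($\downarrow AB$ in it iff neither $A$ nor $B$; $\forall vA$ in it iff all substitution instances $A^b_v$ are); $(\models^0_n)_n$ a fixed enumeration of full sets; for $\alpha>0$, $\mathcal TA\in\models^\alpha_n$ iff for some $\gamma<\alpha$, $A\in\models^\delta_n$ for all $\gamma\le\delta<\alpha$, and $a\in\{x\mid A\}\in\models^\alpha_n$ iff $\mathcal TA^a_x\in\models^\alpha_n$. $\models^\alpha B$ iff $B\in\models^\alpha_n$ for all $n$. $\mathrm{IN}^\alpha(A)$ iff $\models^\beta\mathcal TA$ for all $\beta\ge\alpha$; $\mathrm{IN}(A)$ iff $\exists\alpha\,\mathrm{IN}^\alpha(A)$; $\alpha$ stabilizes $A$ iff ($\mathrm{IN}(A)\Rightarrow\mathrm{IN}^\alpha(A)$)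 and ($\models^\alpha\mathcal TA\Rightarrow\mathrm{IN}(A)$); $\varpi$ is the least ordinal stabilizing every sentence. $\Vdash^MA$ iff $\mathcal TA\in\models^\varpi_n$ for all $n$; $\Vdash^OA$ iff $A\in\models^\varpi_n$ for all $n$. A set $b$ is orthodox iff $\Vdash^O\forall x(\mathcal T(x\in b)\vee\mathcal T(x\notin b))$, and paradoxical iff not orthodox.
   Formalization: The formal statement assumes in addition that ϖ > 0, i.e. that the initial enumeration of full sets does not already stabilize every sentence; for contrived enumerations with ϖ = 0 the equivalence fails (e.g. for the power set of the empty set). *)

(* Defs.v *)
(** * Ordinals *)

(* [osup f] is the least ordinal strictly above every [f j], so every
   ordinal of the ambient universe is represented; distinct trees may
   represent the same ordinal, and [oeq] is equality of ordinals. *)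
Inductive Ord : Type := osup : forall J : Type, (J -> Ord) -> Ord.

Fixpoint ole (alpha beta : Ord) {struct alpha} : Prop :=
  match alpha, beta with
  | osup J f, osup K g => forall j : J, exists k : K, ole (f j) (g k)
  end.

Definition olt (alpha beta : Ord) : Prop :=
  match beta with osup K g => exists k : K, ole alpha (g k) end.

Definition oeq (alpha beta : Ord) : Prop := ole alpha beta /\ ole beta alpha.

Definition ozero : Ord := osup Empty_set (fun e => match e with end).

(** * Syntax *)

(* Variables are de Bruijn indices: [Abs A] is {v | A} and [All A] is
   (forall v A), both binding index 0 in [A].  The name terms are [QuoteF A]
   and [QuoteT t]; a variable free in [A] is free in the name of [A], as
   (forall x)(T(x in b) \/ T(x notin b)) requires. *)
Inductive term : Type :=
| Var : nat -> term
| TrueSet : term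
| FSet : term
| Abs : formula -> term
| QuoteF : formula -> term
| QuoteT : term -> term
with formula : Type :=
| In : term -> term -> formula
| Down : formula -> formula -> formula
| All : formula -> formula.

Definition upren (r : nat -> nat) (k : nat) : nat :=
  match k with O => O | S j => S (r j) end.

Fixpoint rent (r : nat -> nat) (t : term) : term :=
  match t with
  | Var k => Var (r k)
  | TrueSet => TrueSet
  | FSet => FSet
  | Abs A => Abs (renf (upren r) A)
  | QuoteF A => QuoteF (renf r A)
  | QuoteT s => QuoteT (rent r s)
  end
with renf (r : nat -> nat) (A : formula) : formula :=
  match A with
  | In s t => In (rent r s) (rent r t)
  | Down B C => Down (renf r B) (renf r C)
  | All B => All (renf (upren r) B)
  end.

Definition lift (t : term) : term := rent S t.

Definition up (s : nat -> term) (k : nat) : term :=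
  match k with O => Var O | S j => lift (s j) end.

Fixpoint substt (s : nat -> term) (t : term) : term :=
  match t with
  | Var k => s k
  | TrueSet => TrueSet
  | FSet => FSet
  | Abs A => Abs (substf (up s) A)
  | QuoteF A => QuoteF (substf s A)
  | QuoteT u => QuoteT (substt s u)
  end
with substf (s : nat -> term) (A : formula) : formula :=
  match A with
  | In t u => In (substt s t) (substt s u)
  | Down B C => Down (substf s B) (substf s C)
  | All B => All (substf (up s) B)
  end.

(* The instance A^b_v, where v is index 0 of [A]. *)
Definition inst (A : formula) (b : term) : formula :=
  substf (fun k => match k with O => b | S j => Var j end) A.

Fixpoint boundt (k : nat) (t : term) : Prop :=
  match t with
  | Var j => j < k
  | TrueSet => True
  | FSet => True
  | Abs A => boundf (S k) A
  | QuoteF A => boundf k A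
  | QuoteT u => boundt k u
  end
with boundf (k : nat) (A : formula) : Prop :=
  match A with
  | In t u => boundt k t /\ boundt k u
  | Down B C => boundf k B /\ boundf k C
  | All B => boundf (S k) B
  end.

Definition sentence (A : formula) : Prop := boundf 0 A.

Definition Neg (A : formula) : formula := Down A A.
Definition Or (A B : formula) : formula := Neg (Down A B).
Definition And (A B : formula) : formula := Down (Neg A) (Neg B).
Definition Imp (A B : formula) : formula := Or (Neg A) B.
Definition Iff (A B : formula) : formula := And (Imp A B) (Imp B A).

Definition Tr (A : formula) : formula := In (QuoteF A) TrueSet.

Definition Eq (a b : term) : formula :=
  All (Imp (In (lift a) (Var 0)) (In (lift b) (Var 0))).
Definition Subset (a b : term) : formula :=
  All (Imp (In (Var 0) (lift a)) (In (Var 0) (lift b))).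

Definition Power (a : term) : term := Abs (Subset (Var 0) (lift a)).
Definition Univ : term := Abs (Eq (Var 0) (Var 0)).

(** * Semantics *)

Definition full (X : formula -> Prop) : Prop :=
  (forall A B, X (Down A B) <-> ~ X A /\ ~ X B) /\
  (forall A, X (All A) <-> forall b : term, X (inst A b)).

Definition stages : Type := Ord -> nat -> formula -> Prop.

(* [M alpha n A] means that A belongs to the full set of index n at stage
   alpha.  The full sets of stage zero are arbitrary; so are, at every stage,
   the values of the atomic formulas on which [sem_Tr] and [sem_Abs] are
   silent (a in F, a in a name or a variable, a in T with a not the name of
   a formula). *)
Record semantics (M : stages) : Prop := {
  sem_oeq : forall alpha beta n A,
    oeq alpha beta -> (M alpha n A <-> M beta n A);
  sem_full : forall alpha n, full (M alpha n);
  sem_Tr : forall alpha n A, olt ozero alpha ->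
    (M alpha n (Tr A) <->
     exists gamma, olt gamma alpha /\
       forall delta, ole gamma delta -> olt delta alpha -> M delta n A);
  sem_Abs : forall alpha n a A, olt ozero alpha ->
    (M alpha n (In a (Abs A)) <-> M alpha n (Tr (inst A a)))
}.

Definition valid_at (M : stages) (alpha : Ord) (B : formula) : Prop :=
  forall n, M alpha n B.

Definition IN_from (M : stages) (alpha : Ord) (A : formula) : Prop :=
  forall beta, ole alpha beta -> valid_at M beta (Tr A).

Definition IN (M : stages) (A : formula) : Prop :=
  exists alpha, IN_from M alpha A.

Definition stabilizes (M : stages) (alpha : Ord) (A : formula) : Prop :=
  (IN M A -> IN_from M alpha A) /\ (valid_at M alpha (Tr A) -> IN M A).

Definition stabilizes_all (M : stages) (alpha : Ord) : Prop :=
  forall A, sentence A -> stabilizes M alpha A.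

(* Existence of the least such ordinal holds for every [semantics M].  It is
   zero exactly when the arbitrary stage-zero sets happen to be stable already,
   and is otherwise a limit. *)
Definition is_varpi (M : stages) (varpi : Ord) : Prop :=
  stabilizes_all M varpi /\
  forall alpha, stabilizes_all M alpha -> ole varpi alpha.

Definition forces_M (M : stages) (varpi : Ord) (A : formula) : Prop :=
  forall n, M varpi n (Tr A).

Definition forces_O (M : stages) (varpi : Ord) (A : formula) : Prop :=
  forall n, M varpi n A.

Definition orthodox (M : stages) (varpi : Ord) (b : term) : Prop :=
  forces_O M varpi
    (All (Or (Tr (In (Var 0) (lift b))) (Tr (Neg (In (Var 0) (lift b)))))).

Definition paradoxical (M : stages) (varpi : Ord) (b : term) : Prop :=
  ~ orthodox M varpi b.

(* Main.v *)
From Stdlib Require Import Classical.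
Require Import Defs.

(** If [varpi] were a successor [beta + 1], then, since T A at [beta + 1] is A
    at [beta], the ordinal [beta] would already stabilize every sentence; so
    [varpi] is a limit.  Below [varpi], the statement forced is that [a] is
    eventually universal, and then every set is eventually in P(a).
    Conversely, suppose that P(a) is orthodox.  Orthodoxy at U says that U is
    eventually in P(a), which makes [a] eventually universal, or eventually
    outside P(a), which makes [a] non-universal at all late stages.  In the
    latter case let [r] be Russell's set: {v | r in r} is alternately empty and
    universal at successive stages, hence alternately inside and outside P(a),
    which contradicts orthodoxy. *)

(** * Ordinals *)

Definition osucc (alpha : Ord) : Ord := osup unit (fun _ => alpha).

Lemma ole_refl (alpha : Ord) : ole alpha alpha.
Proof. induction alpha as [J f IH]; simpl; intro j; exists j; apply IH. Qed.

Lemma ole_trans (alpha beta gamma : Ord) :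
  ole alpha beta -> ole beta gamma -> ole alpha gamma.
Proof.
  revert beta gamma; induction alpha as [J f IH]; intros [K g] [L h] H1 H2 j.
  destruct (H1 j) as [k Hk], (H2 k) as [l Hl]; exists l; eauto.
Qed.

Lemma olt_ole_trans (alpha beta gamma : Ord) :
  olt alpha beta -> ole beta gamma -> olt alpha gamma.
Proof.
  destruct beta as [K g], gamma as [L h]; intros [k Hk] H.
  destruct (H k) as [l Hl]; exists l; eapply ole_trans; eassumption.
Qed.

Lemma ole_olt_trans (alpha beta gamma : Ord) :
  ole alpha beta -> olt beta gamma -> olt alpha gamma.
Proof.
  destruct gamma as [L h]; intros H [l Hl]; exists l.
  eapply ole_trans; eassumption.
Qed.

Lemma olt_osucc_ole (alpha beta : Ord) :
  olt alpha (osucc beta) <-> ole alpha beta.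
Proof. split; [intros [_ H]; exact H | intro H; exists tt; exact H]. Qed.

Lemma osucc_ole_olt (alpha beta : Ord) :
  ole (osucc alpha) beta <-> olt alpha beta.
Proof.
  destruct beta as [K g]; split; [intro H; exact (H tt) | intros H _; exact H].
Qed.

Lemma olt_osucc (alpha : Ord) : olt alpha (osucc alpha).
Proof. apply olt_osucc_ole, ole_refl. Qed.

Lemma olt_ole (alpha beta : Ord) : olt alpha beta -> ole alpha beta.
Proof.
  revert beta; induction alpha as [J f IH]; intros [K g] [k Hk] j.
  exists k; apply IH; eapply olt_ole_trans; [| exact Hk].
  exists j; apply ole_refl.
Qed.

Lemma ole_osucc (alpha : Ord) : ole alpha (osucc alpha).
Proof. apply olt_ole, olt_osucc. Qed.

Lemma olt_irrefl (alpha : Ord) : ~ olt alpha alpha.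
Proof.
  induction alpha as [J f IH]; intros [j Hj]; apply (IH j).
  eapply olt_ole_trans; [| exact Hj]; exists j; apply ole_refl.
Qed.

Lemma ole_or_olt (alpha beta : Ord) : ole alpha beta \/ olt beta alpha.
Proof.
  revert beta; induction alpha as [J f IH]; intros [K g].
  destruct (classic (ole (osup J f) (osup K g))) as [H | H]; [now left | right].
  apply not_all_ex_not in H as [j Hj]; exists j.
  (* No [g k] reaches [f j], so by induction all lie strictly below it, and hence so does their
     strict supremum, weakly. *)
  assert (Hg : forall k, olt (g k) (f j)).
  { intro k; destruct (IH j (g k)) as [Hk | Hk]; [| exact Hk].
    destruct Hj; exists k; exact Hk. }
  destruct (f j) as [L h]; intro k; apply Hg.
Qed.

Lemma ozero_ole (alpha : Ord) : ole ozero alpha.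
Proof. destruct alpha; intros []. Qed.

Lemma olt_ozero (alpha beta : Ord) : olt alpha beta -> olt ozero beta.
Proof. apply ole_olt_trans, ozero_ole. Qed.

Lemma olt_ozero_osucc (alpha : Ord) : olt ozero (osucc alpha).
Proof. apply olt_ozero with alpha, olt_osucc. Qed.

(** * Substitution *)

Scheme term_formula_ind := Induction for term Sort Prop
with formula_term_ind := Induction for formula Sort Prop.

(** Renamings are compared pointwise, which passes under binders through [upren] without functional
    extensionality. *)
Lemma rent_rent (t : term) (r r' r'' : nat -> nat) :
  (forall k, r (r' k) = r'' k) -> rent r (rent r' t) = rent r'' t.
Proof.
  revert t r r' r''.
  apply (term_formula_ind
    (fun t => forall r r' r'' : nat -> nat, (forall k, r (r' k) = r'' k) ->
       rent r (rent r' t) = rent r'' t)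
    (fun A => forall r r' r'' : nat -> nat, (forall k, r (r' k) = r'' k) ->
       renf r (renf r' A) = renf r'' A)); simpl; intros; auto; f_equal; auto;
  apply H; intros [| k]; simpl; auto.
Qed.

Lemma substt_rent (t : term) (s : nat -> term) (r r' : nat -> nat) :
  (forall k, s (r k) = Var (r' k)) -> substt s (rent r t) = rent r' t.
Proof.
  revert t s r r'.
  apply (term_formula_ind
    (fun t => forall (s : nat -> term) (r r' : nat -> nat),
       (forall k, s (r k) = Var (r' k)) -> substt s (rent r t) = rent r' t)
    (fun A => forall (s : nat -> term) (r r' : nat -> nat),
       (forall k, s (r k) = Var (r' k)) -> substf s (renf r A) = renf r' A));
  simpl; intros; auto; f_equal; auto;
  apply H; intros [| k]; simpl; auto; rewrite H0; reflexivity.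
Qed.

Lemma rent_id (t : term) (r : nat -> nat) :
  (forall k, r k = k) -> rent r t = t.
Proof.
  revert t r.
  apply (term_formula_ind
    (fun t => forall r : nat -> nat, (forall k, r k = k) -> rent r t = t)
    (fun A => forall r : nat -> nat, (forall k, r k = k) -> renf r A = A));
  simpl; intros; auto; f_equal; auto;
  apply H; intros [| k]; simpl; auto.
Qed.

Lemma substt_lift (s : nat -> term) (t : term) :
  (forall k, s (S k) = Var k) -> substt s (lift t) = t.
Proof.
  intro H; unfold lift; rewrite substt_rent with (r' := fun k => k) by exact H.
  now apply rent_id.
Qed.

Lemma inst_In_lift (t x : term) : inst (In (Var 0) (lift t)) x = In x t.
Proof. unfold inst; simpl; now rewrite substt_lift. Qed.

Lemma inst_Subset (a x : term) :
  inst (Subset (Var 0) (lift a)) x = Subset x a.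
Proof.
  unfold inst, Subset, Imp, Or, Neg; simpl.
  (* Under the quantifier of [Subset], [a] is lifted twice; the substitution for the outer variable
     removes one lift. *)
  replace (substt _ (lift (lift a))) with (lift a); [reflexivity |].
  unfold lift at 2 3.
  rewrite rent_rent with (r'' := fun k => S (S k)) by reflexivity.
  symmetry; apply substt_rent; reflexivity.
Qed.

Lemma inst_Eq (x : term) : inst (Eq (Var 0) (Var 0)) x = Eq x x.
Proof. reflexivity. Qed.

(** * Full sets *)

Section Full.

Variables (X : formula -> Prop) (HX : full X).

Lemma full_Down (A B : formula) : X (Down A B) <-> ~ X A /\ ~ X B.
Proof. apply HX. Qed.

Lemma full_All (A : formula) : X (All A) <-> forall b, X (inst A b).
Proof. apply HX. Qed.

Lemma full_Neg (A : formula) : X (Neg A) <-> ~ X A.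
Proof. unfold Neg; rewrite full_Down; tauto. Qed.

Lemma full_Or (A B : formula) : X (Or A B) <-> X A \/ X B.
Proof. unfold Or; rewrite full_Neg, full_Down; tauto. Qed.

Lemma full_Imp (A B : formula) : X (Imp A B) <-> (X A -> X B).
Proof. unfold Imp; rewrite full_Or, full_Neg; tauto. Qed.

Lemma full_Iff (A B : formula) : X (Iff A B) <-> (X A <-> X B).
Proof.
  unfold Iff, And; rewrite full_Down, !full_Neg, !full_Imp; tauto.
Qed.

Lemma full_Subset (x a : term) :
  X (Subset x a) <-> forall y, X (In y x) -> X (In y a).
Proof.
  unfold Subset; rewrite full_All.
  assert (E : forall y, inst (Imp (In (Var 0) (lift x)) (In (Var 0) (lift a))) y
    = Imp (In y x) (In y a)).
  { intro y; rewrite <- (inst_In_lift x y), <- (inst_In_lift a y); reflexivity. }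
  split; intros H y; specialize (H y); rewrite E, full_Imp in *; exact H.
Qed.

Lemma full_Eq_refl (x : term) : X (Eq x x).
Proof.
  apply full_All; intro u.
  change (X (Imp (inst (In (lift x) (Var 0)) u) (inst (In (lift x) (Var 0)) u))).
  apply full_Imp; auto.
Qed.

End Full.

(** * Stages *)

(* [Russell] is {v | v notin v}; by [mem_Russell_succ] the set [Blinker] is
   alternately empty and universal at successive stages. *)
Definition Russell : term := Abs (Neg (In (Var 0) (Var 0))).
Definition Blinker : term := Abs (In Russell Russell).

Section Stages.

Variables (M : stages) (HM : semantics M).

Lemma stage_full (alpha : Ord) (n : nat) : full (M alpha n).
Proof. apply (sem_full M HM). Qed.

(** Every nonempty final segment below the successor contains [beta], and [beta] alone is one, up to
    [oeq]; hence the appeal to [sem_oeq]. *)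
Lemma Tr_succ (beta : Ord) (n : nat) (A : formula) :
  M (osucc beta) n (Tr A) <-> M beta n A.
Proof.
  rewrite (sem_Tr M HM) by apply olt_ozero_osucc; split.
  - intros [gamma [H1 H2]]; apply H2; [apply olt_osucc_ole, H1 | apply olt_osucc].
  - intro H; exists beta; split; [apply olt_osucc |].
    intros delta H1 H2; apply olt_osucc_ole in H2.
    apply (sem_oeq M HM beta delta n A); [split |]; assumption.
Qed.

Lemma mem_Abs_succ (beta : Ord) (n : nat) (x : term) (A : formula) :
  M (osucc beta) n (In x (Abs A)) <-> M beta n (inst A x).
Proof.
  rewrite (sem_Abs M HM) by apply olt_ozero_osucc; apply Tr_succ.
Qed.

Lemma mem_Power_succ (beta : Ord) (n : nat) (x a : term) :
  M (osucc beta) n (In x (Power a)) <->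
  forall y, M beta n (In y x) -> M beta n (In y a).
Proof.
  unfold Power; rewrite mem_Abs_succ, inst_Subset.
  apply full_Subset, stage_full.
Qed.

(** Reflexivity of identity needs only fullness, so it holds from stage zero on, and zero is the
    witness. *)
Lemma mem_Univ (alpha : Ord) (n : nat) (x : term) :
  olt ozero alpha -> M alpha n (In x Univ).
Proof.
  intro H; unfold Univ; apply (sem_Abs M HM), (sem_Tr M HM); try exact H.
  exists ozero; split; [exact H |]; intros delta _ _.
  rewrite inst_Eq; apply full_Eq_refl, stage_full.
Qed.

Lemma mem_Russell_succ (beta : Ord) (n : nat) :
  M (osucc beta) n (In Russell Russell) <-> ~ M beta n (In Russell Russell).
Proof.
  unfold Russell at 2; rewrite mem_Abs_succ.
  change (M beta n (Neg (In Russell Russell)) <-> ~ M beta n (In Russell Russell)).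
  apply full_Neg, stage_full.
Qed.

Lemma mem_Blinker_succ (beta : Ord) (n : nat) (x : term) :
  M (osucc beta) n (In x Blinker) <-> M beta n (In Russell Russell).
Proof. apply mem_Abs_succ. Qed.

(** * Why [varpi] is not a successor *)

Lemma IN_Tr (A : formula) : IN M A -> IN M (Tr A).
Proof.
  intros [alpha H]; exists (osucc alpha); intros beta Hb n.
  apply osucc_ole_olt in Hb; apply (sem_Tr M HM); [now apply olt_ozero with alpha |].
  exists alpha; split; [exact Hb |]; intros delta Hd _; apply (H delta Hd n).
Qed.

Lemma IN_from_pred (beta : Ord) (A : formula) :
  IN_from M (osucc beta) (Tr A) -> IN_from M beta A.
Proof.
  intros H delta Hd n; apply Tr_succ, H.
  apply osucc_ole_olt, olt_osucc_ole, Hd.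
Qed.

(** Stability of [Tr A] at [alpha] is used for [A] at [beta]: each [Tr] absorbs one successor
    step. *)
Lemma stabilizes_all_pred (alpha beta : Ord) :
  oeq alpha (osucc beta) -> stabilizes_all M alpha -> stabilizes_all M beta.
Proof.
  intros Heq Hst A HA.
  assert (HTA : sentence (Tr A)) by (split; [exact HA | exact I]).
  destruct (Hst (Tr A) HTA) as [Hfrom Hin].
  assert (K : IN M (Tr A) -> IN_from M beta A).
  { intro H; apply IN_from_pred; intros delta Hd; apply Hfrom; [exact H |].
    eapply ole_trans; [apply Heq | exact Hd]. }
  split.
  - intro H; apply K, IN_Tr, H.
  - intro H; exists beta; apply K, Hin; intro n.
    apply (sem_oeq M HM alpha (osucc beta) n _ Heq), Tr_succ, H.
Qed.

Lemma varpi_limit (varpi gamma : Ord) :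
  is_varpi M varpi -> olt gamma varpi -> olt (osucc gamma) varpi.
Proof.
  intros [Hst Hmin] Hg.
  destruct (ole_or_olt varpi (osucc gamma)) as [H | H]; [exfalso | exact H].
  apply (olt_irrefl gamma), (olt_ole_trans _ _ _ Hg), Hmin.
  apply (stabilizes_all_pred varpi); [split |]; [exact H | | exact Hst].
  apply osucc_ole_olt, Hg.
Qed.

(** * Final segments of the stages below [varpi] *)

Section BelowVarpi.

Variables (varpi : Ord) (Hvarpi : is_varpi M varpi) (Hpos : olt ozero varpi).

Definition eventually (P : Ord -> Prop) : Prop :=
  exists gamma, olt gamma varpi /\
    forall delta, ole gamma delta -> olt delta varpi -> P delta.

Lemma Tr_varpi (n : nat) (A : formula) :
  M varpi n (Tr A) <-> eventually (fun delta => M delta n A).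
Proof. apply (sem_Tr M HM); exact Hpos. Qed.

(** Raising the threshold by one excludes stage zero, where membership is arbitrary; it stays below
    the limit [varpi]. *)
Lemma eventually_pos_impl (P Q : Ord -> Prop) :
  (forall delta, olt ozero delta -> P delta -> Q delta) ->
  eventually P -> eventually Q.
Proof.
  intros H [gamma [Hg HP]]; exists (osucc gamma); split;
    [now apply varpi_limit |].
  intros delta H1 H2; apply osucc_ole_olt in H1; apply H.
  - now apply olt_ozero with gamma.
  - apply HP; [apply olt_ole |]; assumption.
Qed.

Lemma eventually_and (P Q : Ord -> Prop) :
  eventually P -> eventually Q -> eventually (fun delta => P delta /\ Q delta).
Proof.
  intros [b [Hb HP]] [c [Hc HQ]].
  destruct (ole_or_olt b c) as [H | H]; [exists c | exists b; apply olt_ole in H];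
    (split; [assumption |]); intros delta H1 H2; split;
    (apply HP || apply HQ); eauto using ole_trans.
Qed.

(** This shift moves a property to successor stages, where membership is computed from the preceding
    stage. *)
Lemma eventually_succ (P : Ord -> Prop) :
  eventually P -> eventually (fun delta => P (osucc delta)).
Proof.
  intros [gamma [Hg HP]]; exists gamma; split; [exact Hg |].
  intros delta H1 H2; apply HP; [| now apply varpi_limit].
  eapply ole_trans; [exact H1 | apply ole_osucc].
Qed.

Lemma eventually_witness (P : Ord -> Prop) :
  eventually P -> exists delta, P delta.
Proof.
  intros [gamma [Hg HP]]; exists gamma; apply HP; [apply ole_refl | exact Hg].
Qed.

Lemma eventually_mem_Power (n : nat) (x a : term) :
  eventually (fun delta => forall y, M delta n (In y a)) ->
  eventually (fun delta => M delta n (In x (Power a))).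
Proof.
  intros [gamma [Hg H]]; exists (osucc gamma); split; [now apply varpi_limit |].
  intros delta H1 H2; apply osucc_ole_olt in H1.
  assert (H0 : olt ozero delta) by now apply olt_ozero with gamma.
  (* Here [delta] may be a limit, so [mem_Power_succ] does not suffice. *)
  unfold Power; apply (sem_Abs M HM), (sem_Tr M HM); try exact H0.
  exists gamma; split; [exact H1 |]; intros eps He Hed.
  rewrite inst_Subset; apply full_Subset; [apply stage_full |]; intros y _.
  apply H; [exact He |]; apply (ole_olt_trans _ delta); [apply olt_ole |]; assumption.
Qed.

(** [P] holds at two consecutive stages, and Russell's sentence takes opposite values there. *)
Lemma Russell_recurs (P : Ord -> Prop) (n : nat) (b : bool) :
  eventually P ->
  exists delta, P delta /\ (M delta n (In Russell Russell) <-> b = true).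
Proof.
  intro H; destruct (eventually_witness _ (eventually_and _ _ H (eventually_succ _ H)))
    as [delta [H0 H1]].
  pose proof (mem_Russell_succ delta n) as HR.
  destruct (classic (M delta n (In Russell Russell) <-> b = true)) as [Hb | Hb].
  - now exists delta.
  - exists (osucc delta); split; [exact H1 |].
    destruct b; intuition discriminate.
Qed.

Lemma Blinker_undecided (n : nat) (a : term) :
  eventually (fun delta => ~ forall y, M delta n (In y a)) ->
  ~ (eventually (fun delta => M delta n (In Blinker (Power a))) \/
     eventually (fun delta => ~ M delta n (In Blinker (Power a)))).
Proof.
  intros Ha [H | H].
  (* The value of Russell's sentence at [delta] fixes [Blinker] at [delta + 1] and its membership in
     [Power a] at [delta + 2]. If true, [Blinker] is universal at [delta + 1], where [a] is not. *)
  - pose proof (eventually_succ _ (eventually_and _ _ Ha (eventually_succ _ H))) as K.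
    destruct (Russell_recurs _ n true K) as [delta [[Hna Hin] HR]].
    apply Hna; intro y; rewrite mem_Power_succ in Hin.
    apply Hin, mem_Blinker_succ, HR; reflexivity.
  (* If false, [Blinker] is empty at [delta + 1], hence in [Power a] at [delta + 2]. *)
  - pose proof (eventually_succ _ (eventually_succ _ H)) as K.
    destruct (Russell_recurs _ n false K) as [delta [Hout HR]].
    apply Hout, mem_Power_succ; intros y Hy.
    apply mem_Blinker_succ, HR in Hy; discriminate.
Qed.

(** The quantifier and the disjunction are evaluated at [varpi] itself and only [Tr] looks below, so
    the threshold may depend on [x] and [n]. *)
Lemma orthodox_iff (b : term) :
  orthodox M varpi b <->
  forall n x, eventually (fun delta => M delta n (In x b)) \/
              eventually (fun delta => ~ M delta n (In x b)).
Proof.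
  unfold orthodox, forces_O.
  assert (E : forall n x,
    M varpi n (inst (Or (Tr (In (Var 0) (lift b)))
                        (Tr (Neg (In (Var 0) (lift b))))) x) <->
    eventually (fun delta => M delta n (In x b)) \/
    eventually (fun delta => ~ M delta n (In x b))).
  { intros n x.
    (* Substitution acts inside name terms. *)
    change (M varpi n (Or (Tr (inst (In (Var 0) (lift b)) x))
                          (Tr (Neg (inst (In (Var 0) (lift b)) x)))) <->
            eventually (fun delta => M delta n (In x b)) \/
            eventually (fun delta => ~ M delta n (In x b))).
    rewrite inst_In_lift, (full_Or _ (stage_full _ _)), !Tr_varpi.
    enough (eventually (fun delta => M delta n (Neg (In x b))) <->
            eventually (fun delta => ~ M delta n (In x b))) by tauto.
    split; apply eventually_pos_impl; intros delta _ Hd;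
      apply (full_Neg _ (stage_full delta n)); exact Hd. }
  split.
  - intros H n x; apply E, (full_All _ (stage_full varpi n)), H.
  - intros H n; apply (full_All _ (stage_full varpi n)); intro x; apply E, H.
Qed.

Lemma forces_M_universal_iff (a : term) :
  forces_M M varpi (All (Iff (In (Var 0) (lift a)) (In (Var 0) Univ))) <->
  forall n, eventually (fun delta => forall y, M delta n (In y a)).
Proof.
  assert (E : forall n delta, olt ozero delta ->
    (M delta n (All (Iff (In (Var 0) (lift a)) (In (Var 0) Univ))) <->
     forall y, M delta n (In y a))).
  { intros n delta H0; rewrite (full_All _ (stage_full delta n)).
    assert (Ey : forall y, M delta n
      (inst (Iff (In (Var 0) (lift a)) (In (Var 0) Univ)) y) <-> M delta n (In y a)).
    { intro y.
      change (M delta n (Iff (inst (In (Var 0) (lift a)) y) (In y Univ))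
              <-> M delta n (In y a)).
      rewrite inst_In_lift, (full_Iff _ (stage_full delta n)).
      pose proof (mem_Univ delta n y H0); tauto. }
    split; intros H y; apply Ey, H. }
  split; intros H n; specialize (H n); [apply Tr_varpi in H | apply Tr_varpi];
    revert H; apply eventually_pos_impl; intros delta H0 Hd; apply E; assumption.
Qed.

Lemma orthodox_Power_iff (a : term) :
  orthodox M varpi (Power a) <->
  forall n, eventually (fun delta => forall y, M delta n (In y a)).
Proof.
  rewrite orthodox_iff; split; intros H n.
  (* Testing the single set [Univ] makes the threshold uniform in [y], since its inclusion in [a]
     concerns all [y] at once. *)
  - destruct (H n Univ) as [HU | HU]; apply eventually_succ in HU.
    + revert HU; apply eventually_pos_impl; intros delta H0 Hd y.
      rewrite mem_Power_succ in Hd; apply Hd, mem_Univ, H0.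
    + destruct (Blinker_undecided n a); [| apply H].
      revert HU; apply eventually_pos_impl; intros delta _ Hd Hy; apply Hd.
      apply mem_Power_succ; intros y _; apply Hy.
  - intro x; left; apply eventually_mem_Power, H.
Qed.

End BelowVarpi.

End Stages.

Theorem theorem17p0p3
  (M : stages) (HM : semantics M)
  (varpi : Ord) (Hvarpi : is_varpi M varpi) (Hpos : olt ozero varpi)
  (a : term) :
  paradoxical M varpi (Power a) <->
  ~ forces_M M varpi (All (Iff (In (Var 0) (lift a)) (In (Var 0) Univ))).
Proof.
  unfold paradoxical.
  rewrite orthodox_Power_iff, forces_M_universal_iff by assumption.
  reflexivity.
Qed.
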